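(* For every integer $n\ge 3$, $\kappa_2(Q_n^3)\ge 6n-7$.
   Context: The $3$-ary $n$-cube $Q_n^3$ is the graph whose vertices are the strings $x_1x_2\cdots x_n$ with each $x_i\in\{0,1,2\}$, two vertices being adjacent iff they differ in exactly one coordinate (equivalently, iff their Lee distance $D_L(x,y)=\sum_{i}\min((x_i-y_i)\bmod 3,\,3-((x_i-y_i)\bmod 3))$ equals $1$). For a graph $G$ and integer $h\ge 0$, a vertex set $S\subseteq V(G)$ is an $h$-extra vertex-cut if $G-S$ is disconnected and every component of $G-S$ has more than $h$ vertices; $\kappa_h(G)$ is the minimum cardinality of an $h$-extra vertex-cut. *)

(* Defs.v *)
From mathcomp Require Import all_boot.

Set Implicit Arguments.
Unset Strict Implicit.
Unset Printing Implicit Defensive.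

Section ExtraConnectivity.

(* A finite simple graph is given by its adjacency relation, meant to be
   symmetric and irreflexive. *)
Variables (T : finType) (e : rel T).

(* Adjacency in G - S. *)
Definition del_rel (S : {set T}) : rel T :=
  [rel x y | [&& x \notin S, y \notin S & e x y]].

Definition component (S : {set T}) (x : T) : {set T} :=
  [set y | connect (del_rel S) x y].

Definition components (S : {set T}) : {set {set T}} :=
  [set component S x | x in ~: S].

Definition disconnected_after (S : {set T}) : bool := 1 < #|components S|.

Definition extra_cut (h : nat) (S : {set T}) : bool :=
  disconnected_after S && [forall C in components S, h < #|C|].

(* The value is 0 when there is no h-extra vertex-cut; hence a positive lower
   bound on kappa also asserts that a cut exists. *)
Definition kappa (h : nat) : nat :=
  if [pick S | extra_cut h S] is Some S0
  then #|[arg min_(S < S0 | extra_cut h S) #|S|]|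
  else 0.

End ExtraConnectivity.

Definition cube3_vertex (n : nat) : finType := {ffun 'I_n -> 'I_3}.

Definition cube3 (n : nat) : rel (cube3_vertex n) :=
  [rel x y : {ffun 'I_n -> 'I_3} | #|[set i | x i != y i]| == 1].

Lemma cube3_sym n : symmetric (@cube3 n).
Proof.
by move=> x y /=; congr (_ == _); apply: eq_card => i; rewrite !inE eq_sym.
Qed.

Lemma cube3_irrefl n : irreflexive (@cube3 n).
Proof.
move=> x; rewrite /cube3 /= eq_card0 // => i.
by rewrite inE eqxx.
Qed.

(* Main.v *)
Require Import Defs.
From mathcomp Require Import all_boot.
From mathcomp Require Import zify.
(* Call A and B separated when their vertices are pairwise at Hamming distance
   at least 2. If A and B both have at least 1, 2 or 3 vertices, their complement
   has at least 2n, 4n - 3 or 6n - 7 vertices respectively; the three bounds are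
   proved together by induction on n. Cutting the cube along a coordinate gives
   three slices, and the projections to dimension n - 1 of a slice of A and of a
   slice of B are disjoint, even for different slices. Hence a slice meeting only
   one of A, B has a large complement, and the induction hypothesis covers the
   others; these numerical facts about the slices already imply the bounds.
   A 2-extra cut separates a component from all remaining vertices. A cut exists:
   remove the vertices for which exactly one of two fixed coordinates is 0; each
   remaining vertex lies in a triangle along a third coordinate. *)

Set Implicit Arguments.
Unset Strict Implicit.
Unset Printing Implicit Defensive.

(** * Slices along the first coordinate *)

Definition extend (n : nat) (c : 'I_3) (x : cube3_vertex n) : cube3_vertex n.+1 :=
  [ffun i => if unlift ord0 i is Some j then x j else c].

Definition slice (n : nat) (c : 'I_3) (A : {set cube3_vertex n.+1}) :
  {set cube3_vertex n} := [set x | extend c x \in A].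

Lemma extend0 (n : nat) (c : 'I_3) (x : cube3_vertex n) : extend c x ord0 = c.
Proof. by rewrite ffunE unlift_none. Qed.

Lemma extend_lift (n : nat) (c : 'I_3) (x : cube3_vertex n) (j : 'I_n) :
  extend c x (lift ord0 j) = x j.
Proof. by rewrite ffunE liftK. Qed.

Lemma extend_bij (n : nat) :
  bijective (fun p : 'I_3 * cube3_vertex n => extend p.1 p.2).
Proof.
exists (fun x : cube3_vertex n.+1 =>
          (x ord0, [ffun j => x (lift ord0 j)] : cube3_vertex n)).
  move=> [c x] /=; rewrite extend0; congr (_, _).
  by apply/ffunP=> j; rewrite ffunE extend_lift.
move=> x; apply/ffunP=> i /=.
by case: (unliftP ord0 i) => [j ->|->]; rewrite ?extend_lift ?extend0 ?ffunE.
Qed.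

Lemma hamming_extend (n : nat) (c d : 'I_3) (x y : cube3_vertex n) :
  #|[set i | extend c x i != extend d y i]| = (c != d) + #|[set i | x i != y i]|.
Proof.
rewrite -!sum1dep_card big_mkcond big_ord_recl /= !extend0.
congr (_ + _).
by rewrite [RHS]big_mkcond; apply: eq_bigr => j _; rewrite !extend_lift.
Qed.

Lemma card_slices (n : nat) (A : {set cube3_vertex n.+1}) :
  #|A| = \sum_(c < 3) #|slice c A|.
Proof.
rewrite -sum1_card (reindex _ (onW_bij _ (extend_bij n))) /=.
rewrite (eq_bigl (fun p => xpredT p.1 && (p.2 \in slice p.1 A))); last first.
  by move=> p; rewrite inE.
rewrite -(pair_big_dep xpredT (fun c x => x \in slice c A) (fun _ _ => 1)) /=.
by apply: eq_bigr => c _; rewrite sum1_card.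
Qed.

Definition separated (n : nat) (A B : {set cube3_vertex n}) : Prop :=
  forall x y, x \in A -> y \in B -> 1 < #|[set i | x i != y i]|.

Lemma separated_disjoint (n : nat) (A B : {set cube3_vertex n}) :
  separated A B -> [disjoint A & B].
Proof.
move=> sAB; apply/pred0P=> x /=; apply/negP=> /andP[xA xB].
have := sAB x x xA xB; rewrite (_ : [set i | _] = set0) ?cards0 //.
by apply/setP=> i; rewrite !inE eqxx.
Qed.

Lemma separated_slice (n : nat) (c : 'I_3) (A B : {set cube3_vertex n.+1}) :
  separated A B -> separated (slice c A) (slice c B).
Proof.
move=> sAB x y; rewrite !inE => xA yB.
by have := sAB _ _ xA yB; rewrite hamming_extend eqxx.
Qed.

(** A common point would extend to a point of [A] and a point of [B] that differ at most in the
    first coordinate. *)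
Lemma disjoint_slices (n : nat) (c d : 'I_3) (A B : {set cube3_vertex n.+1}) :
  separated A B -> [disjoint slice c A & slice d B].
Proof.
move=> sAB; apply/pred0P=> x /=; apply/negP; rewrite !inE => /andP[xA xB].
have := sAB _ _ xA xB; rewrite hamming_extend (_ : [set i | _] = set0).
  by rewrite cards0; case: (c != d).
by apply/setP=> i; rewrite !inE eqxx.
Qed.

Lemma card_cube3 (n : nat) : #|cube3_vertex n| = 3 ^ n.
Proof. by rewrite card_ffun !card_ord. Qed.

Lemma leq_card_disjoint (n : nat) (A B : {set cube3_vertex n}) :
  [disjoint A & B] -> #|A| + #|B| <= 3 ^ n.
Proof.
by rewrite -leq_card_setU => /eqP <-; rewrite -card_cube3 max_card.
Qed.

Lemma card_separation (n : nat) (A B : {set cube3_vertex n}) :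
  [disjoint A & B] -> #|A| + #|B| + #|~: (A :|: B)| = 3 ^ n.
Proof.
by rewrite -leq_card_setU => /eqP <-; rewrite cardsC card_cube3.
Qed.

Lemma slice_separator (n : nat) (c : 'I_3) (A B : {set cube3_vertex n.+1}) :
  slice c (~: (A :|: B)) = ~: (slice c A :|: slice c B).
Proof. by apply/setP=> x; rewrite !inE. Qed.

(** * The induction on the dimension *)

(* The three bounds are the sizes of the neighbourhoods of a vertex, of an edge,
   and of a path of three vertices not contained in a triangle. *)
Definition separator_bound (n a b s : nat) : Prop :=
  [/\ 1 <= a -> 1 <= b -> 2 * n <= s,
      2 <= a -> 2 <= b -> 4 * n <= s + 3
    & 3 <= a -> 3 <= b -> 6 * n <= s + 7].

(** Exact values for small [n] and a linear lower bound beyond make the induction step a problem of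
    linear arithmetic. *)
Lemma expn3_cases (n : nat) :
  [\/ n = 0 /\ 3 ^ n = 1, n = 1 /\ 3 ^ n = 3, n = 2 /\ 3 ^ n = 9
    | 3 <= n /\ 9 * n <= 3 ^ n].
Proof.
case: n => [|[|[|n]]]; [by constructor 1|by constructor 2|by constructor 3|].
constructor 4; split=> //.
by elim: n => // n IHn; rewrite expnS; lia.
Qed.

Lemma separator_bound_cases (n a b s : nat) :
  (1 <= a -> 1 <= b -> 2 * n <= s) ->
  [\/ a = 0, b = 0 | [/\ 1 <= a, 1 <= b & 2 * n <= s]].
Proof.
case: a => [|a]; first by constructor 1.
case: b => [|b] le_s; first by constructor 2.
by constructor 3; split=> //; apply: le_s.
Qed.

(** If [b0 = 0], then [s0 = N - a0] is at least [b1] and [b2], by the inequalities between different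
    slices; likewise for the other slices and with the roles exchanged. *)
Lemma separator_bound_step (n N a0 a1 a2 b0 b1 b2 s0 s1 s2 : nat) :
  N = 3 ^ n ->
  a0 + b0 + s0 = N -> a1 + b1 + s1 = N -> a2 + b2 + s2 = N ->
  a0 + b1 <= N -> a0 + b2 <= N -> a1 + b0 <= N -> a1 + b2 <= N ->
  a2 + b0 <= N -> a2 + b1 <= N ->
  separator_bound n a0 b0 s0 -> separator_bound n a1 b1 s1 ->
  separator_bound n a2 b2 s2 ->
  separator_bound n.+1 (a0 + a1 + a2) (b0 + b1 + b2) (s0 + s1 + s2).
Proof.
move=> defN E0 E1 E2 H01 H02 H10 H12 H20 H21 [P0 Q0 R0] [P1 Q1 R1] [P2 Q2 R2].
have HN := expn3_cases n; rewrite -defN in HN.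
case: HN => -[? ?];
  case: (separator_bound_cases P0) => [? | ? | [? ? ?]];
  case: (separator_bound_cases P1) => [? | ? | [? ? ?]];
  case: (separator_bound_cases P2) => [? | ? | [? ? ?]];
  clear P0 P1 P2; split=> Ha Hb; subst; lia.
Qed.

Lemma separator_boundP (n : nat) (A B : {set cube3_vertex n}) :
  separated A B -> separator_bound n #|A| #|B| #|~: (A :|: B)|.
Proof.
(* In dimension 0 the left-hand sides of all three bounds vanish. *)
elim: n A B => [|n IHn] A B sAB; first by split.
rewrite !card_slices !big_ord_recr !big_ord0 /= !add0n !slice_separator.
apply: (separator_bound_step (erefl _)).
all: try exact/card_separation/disjoint_slices.
all: try exact/leq_card_disjoint/disjoint_slices.
all: exact/IHn/separated_slice.
Qed.

(** * From extra cuts to separated sets *)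

Lemma component_disjoint (T : finType) (e : rel T) (S : {set T}) (x : T) :
  x \notin S -> [disjoint component e S x & S].
Proof.
move=> xS; apply/pred0P=> y /=; rewrite inE; apply/negP=> /andP[/connectP[p]].
case: (lastP p) => [_ ->|q w]; first by apply/negP.
by rewrite rcons_path last_rcons => /andP[_ /and3P[_ wS _]] -> /(negP wS).
Qed.

(** A vertex outside [S] that equals or is adjacent to a vertex of the component belongs to the
    component. *)
Lemma separated_component (n : nat) (S : {set cube3_vertex n})
    (x : cube3_vertex n) :
  x \notin S ->
  separated (component (@cube3 n) S x) (~: (S :|: component (@cube3 n) S x)).
Proof.
move=> xS y z; rewrite !inE negb_or => xy /andP[zS].
apply: contraR; rewrite -leqNgt leq_eqVlt ltnS leqn0 => /orP[yz|].
  apply: (connect_trans xy); apply: connect1.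
  rewrite /del_rel /= zS /cube3 /= yz !andbT.
  by have /disjointFr -> := component_disjoint (@cube3 n) xS; rewrite ?inE.
rewrite cards_eq0 => /eqP/setP yz; suff -> : z = y by [].
by apply/ffunP=> i; have := yz i; rewrite !inE; case: eqP.
Qed.

Lemma component_eq (T : finType) (e : rel T) (S : {set T}) (x y : T) :
  symmetric e -> y \in component e S x -> component e S y = component e S x.
Proof.
move=> e_sym; rewrite inE => xy; apply/setP=> z; rewrite !inE.
have sc : connect_sym (del_rel e S).
  by apply: sym_connect_sym => u v; rewrite /del_rel /= e_sym andbCA.
by rewrite (same_connect sc xy).
Qed.

Lemma extra_cut_card (n : nat) (S : {set cube3_vertex n}) :
  extra_cut (@cube3 n) 2 S -> 6 * n - 7 <= #|S|.
Proof.
case/andP=> /card_gt1P[_ [_ [/imsetP[x xS ->] /imsetP[y yS ->] neq_xy]]].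
move=> /forall_inP big_comp; rewrite !inE in xS yS.
set C := component _ S x in neq_xy *.
have C_gt2 : 2 < #|C| by apply: big_comp; apply: imset_f; rewrite inE.
(* The side opposite to [C] contains a whole second component, so it too has at least three
   vertices. *)
have sub_yD : component (@cube3 n) S y \subset ~: (S :|: C).
  apply/subsetP=> z zy; rewrite !inE negb_or; apply/andP; split.
    by have /disjointFr -> := component_disjoint (@cube3 n) yS.
  apply: contra neq_xy => zx.
  rewrite /C -(component_eq (@cube3_sym n) zy).
  by rewrite (@component_eq _ _ S x z (@cube3_sym n)) // inE.
have D_gt2 : 2 < #|~: (S :|: C)|.
  apply: leq_trans (subset_leq_card sub_yD).
  by apply: big_comp; apply: imset_f; rewrite inE.
have [_ _ /(_ C_gt2 D_gt2) le_sep] := separator_boundP (separated_component xS).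
rewrite leq_subLR addnC (leq_trans le_sep) // leq_add2r.
apply/subset_leq_card/subsetP=> z; rewrite !inE -/C.
by case: (z \in S); case: (connect _ _ _).
Qed.

(** * Existence of a 2-extra cut *)

Definition update (n : nat) (i : 'I_n) (c : 'I_3) (x : cube3_vertex n) :
  cube3_vertex n := [ffun j => if j == i then c else x j].

Lemma update_adjacent (n : nat) (i : 'I_n) (c d : 'I_3) (x : cube3_vertex n) :
  c != d -> cube3 (update i c x) (update i d x).
Proof.
move=> neq_cd; apply/cards1P; exists i; apply/setP=> j; rewrite !inE !ffunE.
by case: (j == i); rewrite ?neq_cd ?eqxx.
Qed.

Lemma updateK (n : nat) (i : 'I_n) (x : cube3_vertex n) : update i (x i) x = x.
Proof. by apply/ffunP=> j; rewrite ffunE; case: eqP => // ->. Qed.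

Definition plane_cut (n : nat) (i j : 'I_n) : {set cube3_vertex n} :=
  [set x : {ffun 'I_n -> 'I_3} | (x i == ord0) != (x j == ord0)].

(** Outside the cut, coordinates [i] and [j] vanish together or not at all, and a single edge cannot
    change both. *)
Lemma plane_cut_extra (n : nat) (i j k : 'I_n) :
  i != j -> k != i -> k != j -> extra_cut (@cube3 n) 2 (plane_cut i j).
Proof.
move=> neq_ij neq_ki neq_kj; apply/andP; split; last first.
  apply/forall_inP=> C /imsetP[x]; rewrite inE => xS -> {C}.
  have inj_upd : injective (fun c => update k c x).
    by move=> c d /ffunP/(_ k); rewrite !ffunE eqxx.
  have upS c : update k c x \notin plane_cut i j.
    rewrite inE in xS; rewrite inE !ffunE.
    by rewrite ![_ == k]eq_sym (negPf neq_ki) (negPf neq_kj).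
  (* The three values of coordinate [k] give three vertices of the component. *)
  rewrite -[3](card_ord 3) -cardsT -(card_imset setT inj_upd).
  apply/subset_leq_card/subsetP=> _ /imsetP[c _ ->]; rewrite inE.
  case: (eqVneq (x k) c) => [<-|neq]; first by rewrite updateK connect0.
  apply: connect1; rewrite /del_rel /= xS upS /=.
  by rewrite -{1}[x](updateK k); apply: update_adjacent.
pose c0 : cube3_vertex n := [ffun=> ord0].
pose c1 : cube3_vertex n := [ffun=> ord_max].
set S := plane_cut i j; apply/card_gt1P.
exists (component (@cube3 n) S c0), (component (@cube3 n) S c1).
split; try by apply: imset_f; rewrite !inE !ffunE.
suff sub : {subset component (@cube3 n) S c0 <=
              [pred x : {ffun 'I_n -> 'I_3} | x i == ord0]}.
  apply/eqP=> E; have := sub c1; rewrite E !inE connect0 ffunE.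
  by move/(_ isT).
move=> y; rewrite inE => /connectP[p]; rewrite inE.
have: c0 i == ord0 by rewrite ffunE.
elim: p c0 => [|z p IHp] x xi /=; first by move=> _ ->.
case/andP=> /and3P[xS zS xz] pz; apply: IHp pz.
apply/negPn/negP=> zi; move: xS zS.
rewrite !inE xi (negPf zi) !negbK => /eqP xj /eqP zj.
have/cards1P[m Em] := xz.
have : i \in [set m] by rewrite -Em inE; apply: contraNneq zi => <-.
have : j \in [set m].
  by rewrite -Em inE; apply/eqP=> E; rewrite E in xj; rewrite -xj in zj.
by rewrite !inE => /eqP jm /eqP im; rewrite im jm eqxx in neq_ij.
Qed.

Theorem theorem8 (n : nat) (hn : 3 <= n) : 6 * n - 7 <= kappa (@cube3 n) 2.
Proof.
rewrite /kappa; case: pickP => [S0 cutS0|no_cut].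
  by case: arg_minnP => // S cutS _; apply: extra_cut_card.
(* Here [kappa] would be 0, so a cut must be exhibited; [hn] supplies the three coordinates. *)
pose i := Ordinal (leq_trans (isT : 0 < 3) hn).
pose j := Ordinal (leq_trans (isT : 1 < 3) hn).
pose k := Ordinal (leq_trans (isT : 2 < 3) hn).
by have := @plane_cut_extra n i j k isT isT isT; rewrite no_cut.
Qed.
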